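(* Under the hypotheses of the $O(\tau)$ convergence theorem, let $X:[0,\infty)\to\mathbb H$ be the limit of $\underline X_t^\tau$ as $\tau\downarrow0$. Then for all $0\le s\le t$ and all $\xi\in\mathbb H$, \[\frac12\Big(\|X(t)-\xi\|^2_{\mathbb H}-\|X(s)-\xi\|^2_{\mathbb H}\Big)+\frac\lambda2\int_s^t\|X(a)-\xi\|^2_{\mathbb H}\,da+\int_s^t\phi^{\#}_{\rho_0}(X(a))\,da\le(t-s)\,\phi^{\#}_{\rho_0}(\xi).\]
   Context: Hypotheses of the $O(\tau)$ convergence theorem: the standing hypotheses (S) below hold for every $\tau$ in a family $\tau\downarrow0$ (and $|\lambda|\tau<1$ if $\lambda<0$), with $\lim_{\tau\downarrow0}\|X_0^\tau-\mathrm{Id}\|_{\mathbb H}=0$ and $\sup_\tau\|\nabla\phi^{\#}_{\rho_0}(X_0^\tau)\|_{\mathbb H}<\infty$; $\underline X_t^\tau:=X_n^\tau$ for $t\in[n\tau,(n+1)\tau)$, and $\underline X^\tau$ converges locally uniformly in $\mathbb H$ to a locally Lipschitz curve $X$. Standing hypotheses (S): $\rho_0\in\mathcal P_2(\mathbb R^d)$; $\mathbb H=L^2(\mathbb R^d;\rho_0)$ is the Hilbert space of $\rho_0$-square-integrable maps $\mathbb R^d\to\mathbb R^d$; $\phi:\mathcal P_2(\mathbb R^d)\to\mathbb R$ has lift $\phi^{\#}_{\rho_0}(\xi):=\phi(\xi_{\#}\rho_0)$ which is Fréchet differentiable on $\mathbb H$ (gradient $\nabla\phi^{\#}_{\rho_0}$),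 $\lambda$-convex on $\mathbb H$ for some $\lambda\in\mathbb R$, and $\inf_{\mathbb H}\phi^{\#}_{\rho_0}>-\infty$; $\tau>0$ satisfies $\lambda/2+1/\tau>0$. Scheme: $X_{n+1}^\tau$ is the unique minimizer over $\xi\in\mathbb H$ of $\tfrac12\phi^{\#}_{\rho_0}(\xi)+\tfrac12\langle\nabla\phi^{\#}_{\rho_0}(X_n^\tau),\xi\rangle_{\mathbb H}+\tfrac1{2\tau}\|\xi-X_n^\tau\|^2_{\mathbb H}$. *)

(* Defs.v *)
From HB Require Import structures.
From mathcomp Require Import all_boot all_order all_algebra.
From mathcomp Require Import all_classical all_reals all_analysis.
Set Implicit Arguments. Unset Strict Implicit. Unset Printing Implicit Defensive.
Import Order.TTheory GRing.Theory Num.Theory.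
Import numFieldNormedType.Exports.
Local Open Scope classical_set_scope.
Local Open Scope ring_scope.

Definition Rd (R : realType) (d : nat) := 'rV[R]_d.
Definition borelRd (R : realType) (d : nat) :=
  g_sigma_algebraType (@open 'rV[R]_d).

Definition dotRd (R : realType) (d : nat) (u v : 'rV[R]_d) : R :=
  \sum_(i < d) u ord0 i * v ord0 i.
Definition sqnormRd (R : realType) (d : nat) (u : 'rV[R]_d) : R := dotRd u u.

Definition in_P2 (R : realType) (d : nat) (rho0 : probability (borelRd R d) R) :=
  rho0.-integrable setT (fun x : borelRd R d => (@sqnormRd R d x)%:E).

(* Elements of H = L^2(R^d; rho0) are represented by Borel maps R^d -> R^d
   that are rho0-square integrable. *)
Definition inH (R : realType) (d : nat) (rho0 : probability (borelRd R d) R)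
    (xi : 'rV[R]_d -> 'rV[R]_d) : Prop :=
  measurable_fun (T := borelRd R d) (U := borelRd R d) setT xi /\
  rho0.-integrable setT (fun x : borelRd R d => (sqnormRd (xi x))%:E).

Definition innerH (R : realType) (d : nat) (rho0 : probability (borelRd R d) R)
    (xi eta : 'rV[R]_d -> 'rV[R]_d) : R :=
  Rintegral rho0 setT (fun x : borelRd R d => dotRd (xi x) (eta x)).
Definition normH (R : realType) (d : nat) (rho0 : probability (borelRd R d) R)
    (xi : 'rV[R]_d -> 'rV[R]_d) : R :=
  Num.sqrt (innerH rho0 xi xi).

Definition addF (R : realType) (d : nat) (f g : 'rV[R]_d -> 'rV[R]_d) :=
  fun x => f x + g x.
Definition subF (R : realType) (d : nat) (f g : 'rV[R]_d -> 'rV[R]_d) :=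
  fun x => f x - g x.
Definition scaleF (R : realType) (d : nat) (a : R) (f : 'rV[R]_d -> 'rV[R]_d) :=
  fun x => a *: f x.

(* The lift phi#_{rho0}(xi) := phi(xi_# rho0).  phi is a functional on
   (Borel) measures of R^d; only its values on push-forwards xi_# rho0 with
   xi in H (which lie in P_2) are ever used. *)
Definition phi_lift (R : realType) (d : nat) (rho0 : probability (borelRd R d) R)
    (phi : (set (borelRd R d) -> \bar R) -> R) (xi : 'rV[R]_d -> 'rV[R]_d) : R :=
  phi (pushforward (rho0 : set (borelRd R d) -> \bar R)
         (xi : borelRd R d -> borelRd R d)).

Definition frechet_gradient (R : realType) (d : nat)
    (rho0 : probability (borelRd R d) R)
    (F : ('rV[R]_d -> 'rV[R]_d) -> R)
    (G : ('rV[R]_d -> 'rV[R]_d) -> ('rV[R]_d -> 'rV[R]_d)) : Prop :=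
  forall xi, inH rho0 xi ->
    inH rho0 (G xi) /\
    forall eps : R, 0 < eps -> exists2 delta : R, 0 < delta &
      forall h, inH rho0 h -> normH rho0 h < delta ->
        `| F (addF xi h) - F xi - innerH rho0 (G xi) h | <= eps * normH rho0 h.

Definition lambda_convexH (R : realType) (d : nat)
    (rho0 : probability (borelRd R d) R)
    (F : ('rV[R]_d -> 'rV[R]_d) -> R) (lambda : R) : Prop :=
  forall xi eta, inH rho0 xi -> inH rho0 eta ->
  forall t : R, 0 <= t <= 1 ->
    F (addF (scaleF (1 - t) xi) (scaleF t eta)) <=
      (1 - t) * F xi + t * F eta
      - lambda / 2 * t * (1 - t) * (normH rho0 (subF xi eta)) ^+ 2.

Definition bounded_belowH (R : realType) (d : nat)
    (rho0 : probability (borelRd R d) R)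
    (F : ('rV[R]_d -> 'rV[R]_d) -> R) : Prop :=
  exists M : R, forall xi, inH rho0 xi -> M <= F xi.

Definition scheme_objective (R : realType) (d : nat)
    (rho0 : probability (borelRd R d) R)
    (F : ('rV[R]_d -> 'rV[R]_d) -> R)
    (G : ('rV[R]_d -> 'rV[R]_d) -> ('rV[R]_d -> 'rV[R]_d))
    (tau : R) (Xn xi : 'rV[R]_d -> 'rV[R]_d) : R :=
  F xi / 2 + innerH rho0 (G Xn) xi / 2
  + (normH rho0 (subF xi Xn)) ^+ 2 / (2 * tau).

Definition scheme_step (R : realType) (d : nat)
    (rho0 : probability (borelRd R d) R)
    (F : ('rV[R]_d -> 'rV[R]_d) -> R)
    (G : ('rV[R]_d -> 'rV[R]_d) -> ('rV[R]_d -> 'rV[R]_d))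
    (tau : R) (Xn Xn1 : 'rV[R]_d -> 'rV[R]_d) : Prop :=
  inH rho0 Xn1 /\
  forall xi, inH rho0 xi ->
    scheme_objective rho0 F G tau Xn Xn1 <= scheme_objective rho0 F G tau Xn xi.

Definition interp (R : realType) (d : nat) (tau : R)
    (X : nat -> ('rV[R]_d -> 'rV[R]_d)) (t : R) : 'rV[R]_d -> 'rV[R]_d :=
  X (Num.truncn (t / tau)).

(* Main.v *)
Require Import Defs.
From HB Require Import structures.
From mathcomp Require Import all_boot all_order all_algebra.
From mathcomp Require Import all_classical all_reals all_analysis.
From mathcomp Require Import measurable_realfun.
From mathcomp Require Import ring lra.
Import Order.TTheory GRing.Theory Num.Theory.
Import numFieldNormedType.Exports.
Local Open Scope classical_set_scope.
Local Open Scope ring_scope.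
Set Implicit Arguments.
Unset Strict Implicit.
Unset Printing Implicit Defensive.

(* Writing G for the gradient, the Euler-Lagrange equation of one step is
   X_{n+1} - X_n = - tau/2 (G(X_n) + G(X_{n+1})).  Pairing it with
   (X_n + X_{n+1})/2 - xi and using the lambda-convexity inequality at X_n and
   at X_{n+1} yields a discrete evolution variational inequality whose error,
   tau/4 <G(X_{n+1}) - G(X_n), X_{n+1} - X_n>, equals
   - tau^2/8 (|G(X_{n+1})|^2 - |G(X_n)|^2) and therefore telescopes.  A discrete
   Gronwall argument bounds |G(X_n)| on bounded time intervals, so the error is
   O(tau^2), and the bound also makes phi# Lipschitz along the limit curve.  With
   g(y) = phi#(y) + lambda/2 |y - xi|^2 - phi#(xi) the limit tau -> 0 gives
     |X(t) - xi|^2/2 - |X(s) - xi|^2/2 <= - (t - s) g(X(s)) + O((t - s)^2),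
   and subdividing [s, t] turns this into the integral inequality.  Only the
   semi-inner product structure of square-integrable Borel maps is used, so no
   quotient by almost-everywhere equality is needed. *)

(** * Elementary estimates *)

(** Passages to the limit below take this form: an estimate with error [K * e] for every small [e].
    A positive [x] is refuted by an [e] that makes the error at most [x / 2]. *)
Lemma le0_of_small_multiples (R : realType) (x K e0 : R) : 0 < e0 ->
  (forall e, 0 < e -> e <= e0 -> x <= K * e) -> x <= 0.
Proof.
move=> e00 H; rewrite leNgt; apply/negP => x0.
have K1 : 0 < `|K| + 1 by rewrite ltr_wpDl.
pose e := Num.min e0 (x / (2 * (`|K| + 1))).
have ep : 0 < e by rewrite lt_min e00 divr_gt0// mulr_gt0.
have := H e ep; rewrite ge_min lexx => /(_ isT).
have : e * (2 * (`|K| + 1)) <= x.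
  by rewrite -ler_pdivlMr ?mulr_gt0// ge_min lexx orbT.
have := ler_norm K; nra.
Qed.

(* Subdividing [s, t] into n pieces bounds w t - w s by C (t - s)^2 / n. *)
Lemma nonincreasing_of_quadratic_increments (R : realType) (w : R -> R)
    (C s t : R) :
  s <= t ->
  (forall a b, s <= a -> a <= b -> b <= t -> w b - w a <= C * (b - a) ^+ 2) ->
  w t <= w s.
Proof.
move=> st H; rewrite -subr_le0.
apply: (@le0_of_small_multiples _ _ (`|C| * (t - s) ^+ 2) 1) => // e e0 e1.
pose n := (Num.truncn (e^-1)).+1.
have n0 : 0 < n%:R :> R by rewrite ltr0n.
have en : n%:R^-1 <= e.
  rewrite -[leRHS]invrK lef_pV2 ?posrE ?invr_gt0//.
  by apply/ltW; rewrite /n truncnS_gt.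
pose p (i : nat) : R := s + (t - s) * i%:R / n%:R.
have pS i : p i.+1 - p i = (t - s) / n%:R.
  by rewrite /p -natr1; field; rewrite gt_eqF.
have ip i : (i <= n)%N -> w (p i) - w s <= i%:R * (`|C| * ((t - s) / n%:R) ^+ 2).
  elim: i => [|i IH] lein.
    by rewrite /p mulr0n !(mulr0, mul0r) addr0 subrr.
  have := IH (ltnW lein).
  have d0 : 0 <= (t - s) / n%:R by rewrite divr_ge0 ?subr_ge0// ltW.
  have h1 : s <= p i.
    by rewrite /p lerDl -mulrA mulr_ge0 ?subr_ge0// divr_ge0// ltW.
  have h2 : p i.+1 <= t.
    rewrite /p -mulrA -lerBrDl ler_piMr ?subr_ge0// ler_pdivrMr// mul1r.
    by rewrite ler_nat.
  have h3 : p i <= p i.+1 by rewrite -subr_ge0 pS.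
  have := H _ _ h1 h3 h2; rewrite pS -natr1.
  have := ler_wpM2r (sqr_ge0 ((t - s) / n%:R)) (ler_norm C).
  move: (`|C| * _) (C * _) => u v; lra.
have := ip n (leqnn n).
have -> : p n = t by rewrite /p; field; rewrite gt_eqF.
move=> /le_trans; apply.
have -> : n%:R * (`|C| * ((t - s) / n%:R) ^+ 2) = `|C| * (t - s) ^+ 2 * n%:R^-1.
  by field; rewrite gt_eqF.
by rewrite ler_wpM2l// mulr_ge0 ?sqr_ge0.
Qed.

(** Turns iterates into values of the interpolant at times in [[s, t]]. The first index takes [s]
    itself as witness, since its grid point may precede [s]; later indices take their grid
    points. *)
Lemma grid_point_in_interval (R : realType) (h s t : R) n : 0 < h -> 0 <= s -> s <= t ->
  (Num.truncn (s / h) <= n <= Num.truncn (t / h))%N ->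
  exists2 a, s <= a <= t & Num.truncn (a / h) = n.
Proof.
move=> h0 s0 st; rewrite leq_eqVlt andb_orl => /orP[/andP[/eqP <- _]|/andP[sn nt]].
  by exists s; rewrite ?lexx.
exists (n%:R * h); last by rewrite mulfK ?gt_eqF// natrK.
apply/andP; split.
  rewrite -ler_pdivrMr//; apply: ltW; apply: lt_le_trans (truncnS_gt _) _.
  by rewrite ler_nat.
rewrite -ler_pdivlMr//; apply: le_trans (_ : (Num.truncn (t / h))%:R <= _).
  by rewrite ler_nat.
by rewrite truncn_le divr_ge0 ?(ltW h0)// (le_trans s0).
Qed.

(** * Semi-inner products *)

Section SemiInnerProduct.
Context (R : realType) (V : lmodType R) (B : V -> V -> R).

Definition semi_inner_product : Prop :=
  [/\ forall u v, B u v = B v u,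
      forall a u v w, B (a *: u + v) w = a * B u w + B v w
    & forall u, 0 <= B u u].

Definition seminorm_of (u : V) : R := Num.sqrt (B u u).

Hypothesis hB : semi_inner_product.
Notation N := seminorm_of.

Lemma sipC u v : B u v = B v u. Proof. by case: hB. Qed.

Lemma sip_ge0 u : 0 <= B u u. Proof. by case: hB. Qed.

Lemma sipDl u v w : B (u + v) w = B u w + B v w.
Proof. by case: hB => _ H _; rewrite -[u]scale1r H mul1r scale1r. Qed.

Lemma sip0l w : B 0 w = 0.
Proof. by have := sipDl 0 0 w; rewrite addr0; lra. Qed.

Lemma sipZl a u w : B (a *: u) w = a * B u w.
Proof. by case: hB => _ H _; rewrite -[a *: u]addr0 H sip0l addr0. Qed.

Lemma sipNl u w : B (- u) w = - B u w.
Proof. by rewrite -scaleN1r sipZl mulN1r. Qed.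

Lemma sipDr u v w : B w (u + v) = B w u + B w v.
Proof. by rewrite sipC sipDl !(sipC w). Qed.

Lemma sipZr a u w : B w (a *: u) = a * B w u.
Proof. by rewrite sipC sipZl (sipC w). Qed.

Lemma sipNr u w : B w (- u) = - B w u.
Proof. by rewrite sipC sipNl (sipC w). Qed.

Definition sipE := (sipDl, sipDr, sipNl, sipNr, sipZl, sipZr).

Lemma seminorm_ge0 u : 0 <= N u. Proof. exact: sqrtr_ge0. Qed.

Lemma seminorm_sqr u : N u ^+ 2 = B u u. Proof. by rewrite sqr_sqrtr// sip_ge0. Qed.

Lemma seminormN u : N (- u) = N u.
Proof. by rewrite /N sipNl sipNr opprK. Qed.

Lemma seminorm_distC u v : N (u - v) = N (v - u).
Proof. by rewrite -seminormN opprB. Qed.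

Lemma seminormZ a u : 0 <= a -> N (a *: u) = a * N u.
Proof.
move=> a0; rewrite /N sipZl sipZr mulrA -expr2 sqrtrM ?sqr_ge0//.
by rewrite sqrtr_sqr ger0_norm.
Qed.

Lemma sip_sqr_le u v : B u v ^+ 2 <= B u u * B v v.
Proof.
have key x y : 0 < B y y -> B x y ^+ 2 <= B x x * B y y.
  move=> y0; have := sip_ge0 (B y y *: x - B x y *: y).
  by rewrite !sipE (sipC y x) => h; rewrite -subr_ge0 -(pmulr_rge0 _ y0); lra.
have [v0|v0] := ltP 0 (B v v); first exact: key.
have [u0|u0] := ltP 0 (B u u); first by rewrite sipC mulrC; exact: key.
have vv : B v v = 0 by apply/eqP; rewrite eq_le v0 sip_ge0.
have uu : B u u = 0 by apply/eqP; rewrite eq_le u0 sip_ge0.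
(* Both vectors are null here, though possibly nonzero; nonnegativity of [B] at [u + v] and [u - v]
   forces [B u v = 0]. *)
have := sip_ge0 (u + v); have := sip_ge0 (u - v).
rewrite !sipE (sipC v u) uu vv => h1 h2.
have -> : B u v = 0 by lra.
by rewrite expr0n mul0r.
Qed.

Lemma Cauchy_Schwarz u v : `|B u v| <= N u * N v.
Proof. by rewrite /N -sqrtrM ?sip_ge0// -sqrtr_sqr ler_wsqrtr// sip_sqr_le. Qed.

Lemma ler_seminormD u v : N (u + v) <= N u + N v.
Proof.
rewrite -(@ler_pXn2r _ 2) ?nnegrE ?addr_ge0 ?seminorm_ge0//.
rewrite sqrrD !seminorm_sqr !sipE (sipC v u).
have := le_trans (ler_norm _) (Cauchy_Schwarz u v); lra.
Qed.

Lemma seminorm_triangle u v w : N (u - w) <= N (u - v) + N (v - w).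
Proof. by apply: le_trans (ler_seminormD _ _); rewrite addrA subrK. Qed.

(** Difference of squares: the two seminorms differ by at most [N (u - v)], and their sum is at most
    the second factor. *)
Lemma seminorm_sqr_dist u v w :
  `|N (u - w) ^+ 2 - N (v - w) ^+ 2| <= N (u - v) * (N (u - v) + 2 * N (u - w)).
Proof.
have := seminorm_triangle u v w; have := seminorm_triangle v u w.
rewrite (seminorm_distC v u).
move: (seminorm_ge0 (u - w)) (seminorm_ge0 (v - w)) (seminorm_ge0 (u - v)).
move: (N (u - w)) (N (v - w)) (N (u - v)) => a b c a0 b0 c0 h1 h2.
rewrite ler_norml; apply/andP; split; nra.
Qed.

End SemiInnerProduct.

(** * Convex functionals and the discrete scheme *)

Section ConvexFunctional.
Context (R : realType) (V : lmodType R) (B : V -> V -> R).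
Context (F : V -> R) (G : V -> V) (lambda : R).
Local Notation N := (seminorm_of B).

Definition gradient_of : Prop := forall x eps, 0 < eps ->
  exists2 delta, 0 < delta &
    forall h, N h < delta -> `|F (x + h) - F x - B (G x) h| <= eps * N h.

Definition lambda_convex : Prop := forall x y t, 0 <= t <= 1 ->
  F ((1 - t) *: x + t *: y) <=
    (1 - t) * F x + t * F y - lambda / 2 * t * (1 - t) * N (x - y) ^+ 2.

Definition step_objective (tau : R) (x y : V) : R :=
  F y / 2 + B (G x) y / 2 + N (y - x) ^+ 2 / (2 * tau).

Hypothesis hB : semi_inner_product B.
Hypothesis hG : gradient_of.
Hypothesis hF : lambda_convex.

Lemma directional_derivative x h eps : 0 < eps ->
  exists2 delta, 0 < delta &
    forall t, 0 < t -> t < delta ->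
      `|F (x + t *: h) - F x - t * B (G x) h| <= t * eps.
Proof.
(* Adding 1 keeps the divisor positive when [N h = 0]. *)
move=> eps0; have n0 : 0 < N h + 1 by rewrite ltr_wpDl// seminorm_ge0.
have [|delta d0 H] := hG x (eps := eps / (N h + 1)); first by rewrite divr_gt0.
exists (delta / (N h + 1)); first by rewrite divr_gt0.
move=> t t0; rewrite ltr_pdivlMr// => td.
have := H (t *: h); rewrite (seminormZ hB _ (ltW t0)) (sipZr hB) => /(_ _)/le_trans; apply.
  by apply: le_lt_trans td; rewrite ler_wpM2l ?(ltW t0)// lerDl.
rewrite mulrCA ler_wpM2l ?(ltW t0)//.
by rewrite mulrAC ler_pdivrMr// ler_wpM2l ?(ltW eps0)// lerDl.
Qed.

Lemma gradient_of_continuous x eps : 0 < eps ->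
  exists2 delta, 0 < delta & forall y, N (y - x) < delta -> `|F y - F x| <= eps.
Proof.
move=> eps0; have [delta d0 H] := hG x (@ltr01 R).
have k0 : 0 < N (G x) + 1 by rewrite ltr_wpDl// seminorm_ge0.
exists (Num.min delta (eps / (N (G x) + 1))).
  by rewrite lt_min d0 divr_gt0.
move=> y; rewrite lt_min => /andP[yd]; rewrite ltr_pdivlMr// => ye.
have := H _ yd; rewrite (addrC x) subrK mul1r.
have := Cauchy_Schwarz hB (G x) (y - x).
move: ye; rewrite !ler_norml.
move: (B (G x) _) (N (G x)) (N (y - x)) => b g n ye /andP[b1 b2] /andP[h1 h2].
by apply/andP; split; lra.
Qed.

(** Convexity along [x + t *: (y - x)], divided by [t], becomes this as [t] tends to 0; the factor
    [1 - t] of the quadratic term leaves an error of order [t]. *)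
Lemma gradient_inequality x y :
  F x + B (G x) (y - x) + lambda / 2 * N (y - x) ^+ 2 <= F y.
Proof.
rewrite -subr_le0.
apply: (@le0_of_small_multiples _ _ (1 + `|lambda| / 2 * N (y - x) ^+ 2) 1) => //.
move=> e e0 e1; have [delta d0 H] := directional_derivative x (y - x) e0.
pose t := Num.min e (delta / 2).
have t0 : 0 < t by rewrite lt_min e0 divr_gt0.
have te : t <= e by rewrite ge_min lexx.
have td : t < delta.
  by rewrite gt_min; apply/orP; right; lra.
have := H _ t0 td.
have t1 : t <= 1 := le_trans te e1.
have := hF x y (t := t); rewrite (ltW t0) t1 => /(_ isT).
have -> : (1 - t) *: x + t *: y = x + t *: (y - x).
  by rewrite scalerBl scale1r scalerBr addrAC addrA.
rewrite (seminorm_distC hB x y) ler_norml => h1 /andP[h2 _].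
have nn : 0 <= N (y - x) ^+ 2 by rewrite sqr_ge0.
rewrite -(ler_pM2l t0).
move: h1 h2 nn; move: (B _ _) (N _ ^+ 2) (F (x + _)) => b n f h1 h2 nn.
have hl := ler_norm lambda.
have tt : t * t * (lambda * n) <= t * e * (`|lambda| * n).
  apply: le_trans (_ : t * t * (`|lambda| * n) <= _).
    by rewrite ler_wpM2l ?mulr_ge0 ?(ltW t0)// ler_wpM2r.
  by rewrite ler_wpM2r ?mulr_ge0// ler_wpM2l// ltW.
lra.
Qed.

Lemma gradient_monotone x y : lambda * N (y - x) ^+ 2 <= B (G y - G x) (y - x).
Proof.
have := gradient_inequality x y; have := gradient_inequality y x.
rewrite (seminorm_distC hB x y) -(opprB y x) !(sipE hB); lra.
Qed.

(** The gradient inequality is taken at [y], so that a bound at an iterate [y] suffices while [z]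
    stays arbitrary. *)
Lemma upper_bound_of_gradient_bound M y z : N (G y) <= M ->
  F y - F z <= M * N (y - z) + `|lambda| / 2 * N (y - z) ^+ 2.
Proof.
move=> yM; have := gradient_inequality y z.
have := Cauchy_Schwarz hB (G y) (z - y); rewrite (seminorm_distC hB z y).
have := ler_wpM2r (seminorm_ge0 B (y - z)) yM.
have : - lambda * N (y - z) ^+ 2 <= `|lambda| * N (y - z) ^+ 2.
  by rewrite ler_wpM2r ?sqr_ge0// -normrN ler_norm.
rewrite ler_norml => h1 h2 /andP[h3 _]; lra.
Qed.

(** * Estimates for the discrete scheme *)

Section Scheme.
Context (tau : R) (x : nat -> V).
Hypothesis tau0 : 0 < tau.
Hypothesis xmin : forall n y,
  step_objective tau (x n) (x n.+1) <= step_objective tau (x n) y.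
Local Notation b n := (B (G (x n)) (G (x n))).

Lemma scheme_Euler_Lagrange n h :
  B (x n.+1 - x n) h = - (tau / 2) * B (G (x n.+1) + G (x n)) h.
Proof.
(* Comparing the minimizer with [x n.+1 + t *: k] gives an inequality that is linear in [k]; its use
   at [h] and [- h] gives the equation. *)
have key k : 0 <= B (x n.+1 - x n) k + tau / 2 * B (G (x n.+1) + G (x n)) k.
  rewrite -oppr_le0.
  apply: (@le0_of_small_multiples _ _ (tau / 2 + N k ^+ 2 / 2) 1) => //.
  move=> e e0 e1; have [delta d0 H] := directional_derivative (x n.+1) k e0.
  pose t := Num.min e (delta / 2).
  have t0 : 0 < t by rewrite lt_min e0 divr_gt0.
  have te : t <= e by rewrite ge_min lexx.
  have td : t < delta.
    by rewrite gt_min; apply/orP; right; lra.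
  have := H _ t0 td; have := xmin n (x n.+1 + t *: k).
  rewrite ler_norml /step_objective addrAC !(seminorm_sqr hB) !(sipE hB).
  rewrite (sipC hB k (x n.+1)) (sipC hB k (x n)) (sipC hB (x n) (x n.+1)).
  have nn := sip_ge0 hB k.
  move: nn; move: (B k k) (F (x n.+1 + t *: k)) (F (x n.+1)) => kk f1 f0 nn.
  rewrite -(ler_pM2l tau0) => h1 /andP[_ h2].
  rewrite -(ler_pM2l t0).
  have h3 : tau * (f1 - f0 - t * B (G (x n.+1)) k) <= tau * (t * e).
    by rewrite ler_wpM2l// ltW.
  have h4 : t * t * kk <= t * e * kk by rewrite ler_wpM2r// ler_wpM2l// ltW.
  have tn : tau != 0 by rewrite gt_eqF.
  move: h1; rewrite !mulrDr !mulrA.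
  rewrite !(mulrAC _ _ (2 * tau)^-1).
  have -> : tau / (2 * tau) = 1 / 2 by field.
  move: h3 h4; lra.
have := key h; have := key (- h); rewrite !(sipE hB); lra.
Qed.

(** Testing the Euler-Lagrange equation twice gives [tau ^+ 2 / 4] times the square of the sum of
    the gradients, and the square of their difference is nonnegative. *)
Lemma scheme_step_sqr n :
  N (x n.+1 - x n) ^+ 2 <= tau ^+ 2 / 2 * (b n + b n.+1).
Proof.
rewrite (seminorm_sqr hB) scheme_Euler_Lagrange (sipC hB) scheme_Euler_Lagrange.
have := sip_ge0 hB (G (x n.+1) - G (x n)).
rewrite !(sipE hB) (sipC hB (G (x n)) (G (x n.+1))).
move: (B _ _) (b n) (b n.+1) => p q r h.
have := mulr_ge0 (sqr_ge0 tau) h; rewrite expr2; lra.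
Qed.

Lemma scheme_gradient_increment n :
  B (G (x n.+1) - G (x n)) (x n.+1 - x n) = - (tau / 2) * (b n.+1 - b n).
Proof.
rewrite (sipC hB) scheme_Euler_Lagrange !(sipE hB) (sipC hB (G (x n)) (G (x n.+1))).
ring.
Qed.

(** Let [a] be [tau] times the absolute value of [lambda]. Monotonicity of the gradient and the step
    bound give [b n.+1 * (1 - a) <= b n * (1 + a)], and [1 + a <= (1 + 4 * a) * (1 - a)] for
    [0 <= a <= 1 / 2]. *)
Lemma scheme_gradient_growth n : `|lambda| * tau <= 1 / 2 ->
  b n.+1 <= (1 + 4 * (`|lambda| * tau)) * b n.
Proof.
move=> a2; have := gradient_monotone (x n) (x n.+1).
rewrite scheme_gradient_increment => h1.
have := scheme_step_sqr n => h2.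
have l0 := normr_ge0 lambda.
have h3 : - `|lambda| * (tau ^+ 2 / 2 * (b n + b n.+1)) <=
    - (tau / 2) * (b n.+1 - b n).
  apply: le_trans h1; rewrite mulNr lerNl -mulNr.
  apply: le_trans (_ : `|lambda| * N (x n.+1 - x n) ^+ 2 <= _).
    by rewrite ler_wpM2r ?sqr_ge0// -normrN ler_norm.
  by rewrite ler_wpM2l.
have h4 : b n.+1 * (1 - `|lambda| * tau) <= b n * (1 + `|lambda| * tau).
  have : 0 <= tau * (b n * (1 + `|lambda| * tau) - b n.+1 * (1 - `|lambda| * tau)).
    by move: h3; rewrite expr2; lra.
  by rewrite pmulr_rge0// subr_ge0.
have b0 := sip_ge0 hB (G (x n)); have b1 := sip_ge0 hB (G (x n.+1)).
have a0 : 0 <= `|lambda| * tau by rewrite mulr_ge0// ltW.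
move: h4 b0 b1 a0 a2; move: (b n) (b n.+1) (`|lambda| * tau) => p q a.
move=> h4 p0 q0 a0 a2; rewrite -(@ler_pM2r _ (1 - a)); last by lra.
apply: le_trans h4 _.
have a1 : 0 <= 1 - 2 * a by lra.
have := mulr_ge0 p0 (mulr_ge0 a0 a1); lra.
Qed.

(** Discrete Gronwall estimate, through [1 + z <= expR z]. *)
Lemma scheme_gradient_bound n (T : R) : `|lambda| * tau <= 1 / 2 ->
  n%:R * tau <= T -> b n <= expR (4 * `|lambda| * T) * b 0%N.
Proof.
move=> a2 nT.
apply: le_trans (_ : expR (4 * (`|lambda| * tau) * n%:R) * b 0%N <= _).
  elim: n {nT} => [|n IH]; first by rewrite mulr0 expR0 mul1r.
  apply: le_trans (scheme_gradient_growth n a2) _.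
  rewrite -[n.+1%:R]natr1 mulrDr mulr1 [X in expR X]addrC expRD -mulrA.
  apply: ler_pM => //; rewrite ?(sip_ge0 hB)//; last exact: expR_ge1Dx.
  by rewrite addr_ge0// !mulr_ge0// ltW.
rewrite ler_wpM2r ?(sip_ge0 hB)// ler_expR -!mulrA ler_wpM2l// ler_wpM2l//.
by rewrite mulrC.
Qed.

(** The evolution variational inequality bounds the derivative of half the squared distance to [xi]
    by minus this quantity. *)
Definition evi_defect (xi y : V) : R := F y + lambda / 2 * N (y - xi) ^+ 2 - F xi.

(* The remainder telescopes because, by the Euler-Lagrange equation, the
   increment of the squared gradient norm is a multiple of
   <G (x n.+1) - G (x n), x n.+1 - x n>. *)
Lemma scheme_one_step_evi n xi :
  N (x n.+1 - xi) ^+ 2 / 2 - N (x n - xi) ^+ 2 / 2 <=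
  - (tau / 2) * (evi_defect xi (x n) + evi_defect xi (x n.+1))
  - tau ^+ 2 / 8 * (b n.+1 - b n).
Proof.
(* The increment of the squared distance is the sum of these two pairings. The gradient inequality
   handles each gradient paired with its own point; moving the crossed terms there costs the
   quantity evaluated in [e3]. *)
have e1 := scheme_Euler_Lagrange n (x n - xi).
have e2 := scheme_Euler_Lagrange n (x n.+1 - xi).
have e3 := scheme_gradient_increment n.
have h1 := gradient_inequality (x n) xi.
have h2 := gradient_inequality (x n.+1) xi.
move: h1 h2; rewrite (seminorm_distC hB xi) (seminorm_distC hB xi (x n.+1)).
rewrite /evi_defect -subr_ge0 -(pmulr_rge0 _ tau0) => h1.
rewrite -subr_ge0 -(pmulr_rge0 _ tau0) => h2.
have q : N (x n.+1 - xi) ^+ 2 - N (x n - xi) ^+ 2 =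
    B (x n.+1 - x n) (x n - xi) + B (x n.+1 - x n) (x n.+1 - xi).
  rewrite !(seminorm_sqr hB) !(sipE hB) (sipC hB xi (x n.+1)) (sipC hB xi (x n)).
  by rewrite (sipC hB (x n.+1) (x n)); ring.
move: e1 e2 q h1 h2; move: (N (x n.+1 - xi) ^+ 2) (N (x n - xi) ^+ 2) => s1 s0.
have e4 := congr1 (fun z => tau * z) e3; move: e4 {e3} => /=.
rewrite [B (G _ - _) _](sipE hB) !(sipE hB) expr2 => e4 e1 e2 q h1 h2.
lra.
Qed.

Lemma scheme_evi m k xi gamma :
  (forall n, (m <= n <= m + k)%N -> gamma <= evi_defect xi (x n)) ->
  N (x (m + k)%N - xi) ^+ 2 / 2 - N (x m - xi) ^+ 2 / 2 <=
  - (tau * k%:R) * gamma + tau ^+ 2 / 8 * b m.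
Proof.
move=> hg.
(* The induction carries the telescoped remainder; its final gradient term has a favourable sign and
   is dropped here. *)
suff : N (x (m + k)%N - xi) ^+ 2 / 2 - N (x m - xi) ^+ 2 / 2 <=
    - (tau * k%:R) * gamma - tau ^+ 2 / 8 * (b (m + k)%N - b m).
  have := mulr_ge0 (sqr_ge0 tau) (sip_ge0 hB (G (x (m + k)%N))); lra.
elim: k hg => [|k IH] hg; first by rewrite addn0; lra.
have mk n : (m <= n <= m + k)%N -> gamma <= evi_defect xi (x n).
  by case/andP=> mn nk; apply: hg; rewrite mn addnS leqW.
have h1 : gamma <= evi_defect xi (x (m + k)%N) by apply: mk; rewrite leq_addr /=.
have h2 : gamma <= evi_defect xi (x (m + k).+1).
  by apply: hg; rewrite addnS leqnn leqW ?leq_addr.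
have h3 : tau / 2 * (gamma + gamma) <=
    tau / 2 * (evi_defect xi (x (m + k)%N) + evi_defect xi (x (m + k).+1)).
  by rewrite ler_wpM2l ?divr_ge0 ?(ltW tau0)// lerD.
have := IH mk; have := scheme_one_step_evi (m + k) xi.
rewrite addnS -[k.+1%:R]natr1; lra.
Qed.

End Scheme.
End ConvexFunctional.

(** * Integrals of Lipschitz functions *)

Section LipschitzIntegral.
Context (R : realType) (f : R -> R) (L T : R).
Hypothesis flip : forall a b, 0 <= a <= T -> 0 <= b <= T ->
  `|f a - f b| <= L * `|a - b|.
Local Notation mu := (@lebesgue_measure R).

Lemma lipschitz_integrable s t : 0 <= s -> t <= T ->
  mu.-integrable `[s, t] (EFin \o f).
Proof.
move=> s0 tT; apply: continuous_compact_integrable; first exact: segment_compact.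
apply/subspace_continuousP => a /=; rewrite in_itv/= => /andP[sa at_].
apply/cvgrPdist_le => e e0.
have L0 : 0 < `|L| + 1 by rewrite ltr_wpDl.
near=> b.
have : `[s, t]%classic b by near: b; exact: withinT.
rewrite /= in_itv/= => /andP[sb bt].
have ab : `|a - b| < e / (`|L| + 1).
  near: b; apply: cvg_within; apply/nbhs_normP.
  by exists (e / (`|L| + 1)) => //=; rewrite divr_gt0.
move: ab; rewrite ltr_pdivlMr// => ab.
apply: le_trans (flip _ _) _.
- by rewrite (le_trans s0 sa) (le_trans at_ tT).
- by rewrite (le_trans s0 sb) (le_trans bt tT).
have := ler_norm L; have := normr_ge0 (a - b); nra.
Unshelve. all: by end_near. Qed.

(** Left rectangle rule: on [[s, t]] the integrand lies between two constants that differ from [f s]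
    by the absolute value of [L] times [t - s]. *)
Lemma lipschitz_Rintegral_approx s t : 0 <= s -> s <= t -> t <= T ->
  `|Rintegral mu `[s, t] f - (t - s) * f s| <= `|L| * (t - s) ^+ 2.
Proof.
move=> s0 st tT.
have mst : fine (mu `[s, t]) = t - s.
  rewrite lebesgue_measure_itv/= lte_fin; case: ltP => //= ts.
  by apply/esym/eqP; rewrite subr_eq0 eq_le ts.
have ic c : mu.-integrable `[s, t] (EFin \o cst c).
  apply: continuous_compact_integrable; first exact: segment_compact.
  by apply: continuous_subspaceT => ?; exact: cvg_cst.
have intf := lipschitz_integrable s0 tT.
have bnd c : s <= c <= t -> `|f c - f s| <= `|L| * (t - s).
  move=> /andP[sc ct]; apply: le_trans (flip _ _) _.
  - by rewrite (le_trans s0 sc) (le_trans ct tT).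
  - by rewrite s0 (le_trans st tT).
  rewrite (ger0_norm (_ : 0 <= c - s)) ?subr_ge0//.
  apply: le_trans (_ : `|L| * (c - s) <= _).
    by rewrite ler_wpM2r ?subr_ge0// ler_norm.
  by rewrite ler_wpM2l// lerD2r.
rewrite ler_norml; apply/andP; split.
- have h : forall c, `[s, t]%classic c -> cst (f s - `|L| * (t - s)) c <= f c.
    move=> c /=; rewrite in_itv/= => /bnd; rewrite ler_norml => /andP[]; lra.
  have := @le_Rintegral _ _ R mu `[s, t] (cst (f s - `|L| * (t - s))) f
    (measurable_itv _) (ic _) intf h.
  by rewrite Rintegral_cst// mst expr2; lra.
- have h : forall c, `[s, t]%classic c -> f c <= cst (f s + `|L| * (t - s)) c.
    move=> c /=; rewrite in_itv/= => /bnd; rewrite ler_norml => /andP[]; lra.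
  have := @le_Rintegral _ _ R mu `[s, t] f (cst (f s + `|L| * (t - s)))
    (measurable_itv _) intf (ic _) h.
  by rewrite Rintegral_cst// mst expr2; lra.
Qed.

Lemma lipschitz_Rintegral_split s b t : 0 <= s -> s <= b -> b <= t -> t <= T ->
  Rintegral mu `[s, t] f - Rintegral mu `[s, b] f = Rintegral mu `[b, t] f.
Proof.
move=> s0 sb bt tT; rewrite Rintegral_itvB ?bnd_simp//; last first.
  exact: lipschitz_integrable.
(* The difference is an integral over a half-open interval, and the endpoint [b] is
   Lebesgue-null. *)
rewrite Rintegral_itv_obnd_cbnd//.
apply: (integrableS _ _ _ (lipschitz_integrable s0 tT)) => //.
by apply: subset_itvr; rewrite bnd_simp.
Qed.

End LipschitzIntegral.

(** * The limit curve *)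

Section SchemeLimit.
Context (R : realType) (V : lmodType R) (B : V -> V -> R).
Context (F : V -> R) (G : V -> V) (lambda : R).
Context (tau : nat -> R) (x : nat -> nat -> V) (X : R -> V) (C : R).
Local Notation N := (seminorm_of B).
Local Notation g := (evi_defect B F lambda).
Local Notation mu := (@lebesgue_measure R).

Hypothesis hB : semi_inner_product B.
Hypothesis hG : gradient_of B F G.
Hypothesis hF : lambda_convex B F lambda.
Hypothesis tau0 : forall k, 0 < tau k.
Hypothesis tau_cvg : tau @ \oo --> 0.
Hypothesis xmin : forall k n y,
  step_objective B F G (tau k) (x k n) (x k n.+1) <=
  step_objective B F G (tau k) (x k n) y.
Hypothesis xC : forall k, N (G (x k 0%N)) <= C.
Hypothesis Xlip : forall T, 0 <= T -> exists L, forall s t,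
  0 <= s <= T -> 0 <= t <= T -> N (X t - X s) <= L * `|t - s|.
Hypothesis Xcvg : forall T, 0 <= T -> forall eps, 0 < eps -> exists K,
  forall k, (K <= k)%N -> forall t, 0 <= t <= T ->
    N (x k (Num.truncn (t / tau k)) - X t) <= eps.

Lemma eventually_small_step e : 0 < e ->
  exists K, forall k, (K <= k)%N -> tau k <= e.
Proof.
move=> e0; have /cvgr0Pnorm_le/(_ _ e0) [K _ H] := tau_cvg.
by exists K => k /H /=; apply: le_trans; exact: ler_norm.
Qed.

Lemma scheme_gradient_locally_bounded T : 0 <= T ->
  exists2 M, 0 <= M & exists K, forall k, (K <= k)%N -> forall t, 0 <= t <= T ->
    N (G (x k (Num.truncn (t / tau k)))) <= M.
Proof.
move=> T0; exists (Num.sqrt (expR (4 * `|lambda| * T) * C ^+ 2)).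
  exact: sqrtr_ge0.
have l0 : 0 < `|lambda| + 1 by rewrite ltr_wpDl.
(* This threshold ensures the smallness of the step that [scheme_gradient_bound] requires; the added
   1 covers [lambda = 0]. *)
have [|K HK] := @eventually_small_step (1 / 2 / (`|lambda| + 1)).
  by rewrite !divr_gt0.
exists K => k /HK tk t /andP[t0 tT].
rewrite ler_wsqrtr//.
apply: le_trans (scheme_gradient_bound hB hG hF (tau0 k) (@xmin k) (T := T) _ _) _.
- move: tk; rewrite ler_pdivlMr// => tk.
  by apply: le_trans tk; rewrite mulrC ler_wpM2l ?(ltW (tau0 k))// lerDl.
- apply: le_trans tT; rewrite -ler_pdivlMr// truncn_le.
  by rewrite divr_ge0// ltW.
rewrite ler_wpM2l ?expR_ge0// -(seminorm_sqr hB).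
rewrite ler_sqr ?nnegrE ?seminorm_ge0//.
exact: le_trans (seminorm_ge0 _ _) (xC k).
Qed.

(** Gradients are bounded along the iterates; continuity of [F] carries the resulting estimate on
    [F] over to the curve. *)
Lemma limit_upper_bound T : 0 <= T -> exists2 M, 0 <= M &
  (exists K, forall k, (K <= k)%N -> forall t, 0 <= t <= T ->
    N (G (x k (Num.truncn (t / tau k)))) <= M) /\
  (forall a z, 0 <= a <= T ->
    F (X a) - F z <= M * N (X a - z) + `|lambda| / 2 * N (X a - z) ^+ 2).
Proof.
move=> T0; have [M M0 [K HK]] := scheme_gradient_locally_bounded T0.
exists M => //; split; first by exists K.
move=> a z aT; rewrite -subr_le0.
set n := N (X a - z); have n0 : 0 <= n by exact: seminorm_ge0.
(* Error budget: [1] for replacing [F y] by [F (X a)], the rest for [N (y - z) <= n + e], using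
   [(n + e) ^+ 2 - n ^+ 2 <= (2 * n + 1) * e]. *)
apply: (@le0_of_small_multiples _ _ (1 + M + `|lambda| / 2 * (2 * n + 1)) 1) => //.
move=> e e0 e1.
have [d d0 Hd] := gradient_of_continuous hB hG (X a) e0.
have m0 : 0 < Num.min e (d / 2) by rewrite lt_min e0 divr_gt0.
have [K' HK'] := Xcvg T0 m0.
pose k := maxn K K'.
have := HK' k (leq_maxr _ _) a aT.
have := HK k (leq_maxl _ _) a aT.
set y := x k _ => yM; rewrite le_min => /andP[ye yd].
have h1 := upper_bound_of_gradient_bound hB hG hF z yM.
have /Hd : N (y - X a) < d by lra.
rewrite ler_norml => /andP[h2 _].
have h3 : N (y - z) <= n + e.
  by apply: le_trans (seminorm_triangle hB y (X a) z) _; rewrite addrC lerD2l.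
have h4 : M * N (y - z) <= M * (n + e) by rewrite ler_wpM2l.
have h5 : `|lambda| / 2 * N (y - z) ^+ 2 <= `|lambda| / 2 * (n + e) ^+ 2.
  rewrite ler_wpM2l ?divr_ge0// ler_sqr ?nnegrE ?seminorm_ge0//.
  by rewrite addr_ge0// ltW.
have h6 : `|lambda| / 2 * e ^+ 2 <= `|lambda| / 2 * e.
  by rewrite ler_wpM2l ?divr_ge0// expr2 ler_piMr// ltW.
clearbody n; move: h1 h2 h4 h5 h6; move: (N (y - z)) (F y) => p fy; lra.
Qed.

(** Iterates at times in [[s, t]] stay within a multiple of [t - s] of [X s], up to a vanishing
    error, so their defect is at least that of [X s] minus a multiple of [t - s]. This lower bound
    is the [gamma] fed to [scheme_evi]. *)
Lemma limit_local_evi xi T : 0 <= T -> exists K0, forall s t,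
  0 <= s -> s <= t -> t <= T ->
  N (X t - xi) ^+ 2 / 2 - N (X s - xi) ^+ 2 / 2 <=
  - (t - s) * g xi (X s) + K0 * (t - s) ^+ 2.
Proof.
move=> T0; have [M M0 [[K1 HK1] HM]] := limit_upper_bound T0.
have [L0 HL0] := Xlip T0; pose L := `|L0|.
have HL s t : 0 <= s <= T -> 0 <= t <= T -> N (X t - X s) <= L * `|t - s|.
  by move=> hs ht; apply: le_trans (HL0 _ _ hs ht) _; rewrite ler_wpM2r// ler_norm.
have L_ge0 : 0 <= L by exact: normr_ge0.
pose D := N (X 0 - xi) + L * T.
have D0 : 0 <= D by rewrite addr_ge0 ?seminorm_ge0 ?mulr_ge0.
have HD a : 0 <= a <= T -> N (X a - xi) <= D.
  move=> /[dup] aT /andP[a0 aT'].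
  apply: le_trans (seminorm_triangle hB _ (X 0) _) _; rewrite addrC lerD2l.
  apply: le_trans (HL 0 a _ aT) _; first by rewrite lexx.
  by rewrite subr0 ger0_norm// ler_wpM2l.
(* One-sided Lipschitz constant of the defect, from [limit_upper_bound] and [seminorm_sqr_dist], for
   distances up to [L * T + 1]; the [1] leaves room for [e <= 1]. *)
pose kappa := M + `|lambda| * (L * T + 1 + D).
have LT0 : 0 <= L * T by rewrite mulr_ge0.
have kappa0 : 0 <= kappa by rewrite addr_ge0// mulr_ge0// addr_ge0// addr_ge0.
have Hg a y r : 0 <= a <= T -> N (X a - y) <= r -> r <= L * T + 1 ->
    g xi (X a) - g xi y <= kappa * r.
  move=> aT yr rLT; have h1 := HM a y aT.
  have := seminorm_sqr_dist hB (X a) y xi; have := HD _ aT.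
  have := seminorm_ge0 B (X a - y).
  move: h1 yr; rewrite /evi_defect; move: (N (X a - y)) => n h1 nr n0 hD hs.
  have h2 : lambda * (N (X a - xi) ^+ 2 - N (y - xi) ^+ 2) <=
      `|lambda| * (n * (n + 2 * D)).
    apply: le_trans (ler_norm _) _; rewrite normrM ler_wpM2l//.
    by apply: le_trans hs _; rewrite ler_wpM2l// lerD2l ler_wpM2l.
  have h3 : n * (M + `|lambda| * (n + D)) <= r * kappa.
    apply: ler_pM => //.
      by rewrite addr_ge0// mulr_ge0// addr_ge0.
    by rewrite lerD2l ler_wpM2l// lerD2r (le_trans nr).
  move: h1; rewrite expr2; lra.
exists (kappa * L) => s t s0 st tT.
have sT : 0 <= s <= T by rewrite s0 (le_trans st).
have tT' : 0 <= t <= T by rewrite (le_trans s0 st).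
pose Gamma := `|g xi (X s)| + kappa * (L * T + 1).
rewrite -subr_le0.
(* Error budget: [1 + 2 * D] for replacing iterates by [X] at both ends, [T * kappa] for the [e]
   inside [r], [Gamma] for replacing the discrete elapsed time by [t - s], and [M ^+ 2 / 8] for the
   gradient term of [scheme_evi]. *)
apply: (@le0_of_small_multiples _ _
  (1 + 2 * D + T * kappa + Gamma + M ^+ 2 / 8) 1) => // e e0 e1.
have [K2 HK2] := Xcvg T0 e0.
have [K3 HK3] := eventually_small_step e0.
pose k := maxn K1 (maxn K2 K3).
have Xk := HK2 k (leq_trans (leq_maxl _ _) (leq_maxr _ _)).
have tk := HK3 k (leq_trans (leq_maxr _ _) (leq_maxr _ _)).
have Gk := HK1 k (leq_maxl _ _).
pose m := Num.truncn (s / tau k); pose n := Num.truncn (t / tau k).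
have mn : (m <= n)%N by apply: le_truncn; rewrite ler_pM2r ?invr_gt0.
pose r := L * (t - s) + e.
have rLT : r <= L * T + 1.
  by rewrite lerD// ler_wpM2l// lerBlDr (le_trans tT)// lerDl.
pose gamma := g xi (X s) - kappa * r.
have hgamma i : (m <= i <= m + (n - m))%N -> gamma <= g xi (x k i).
  rewrite subnKC// => /(grid_point_in_interval (tau0 k) s0 st)[a /andP[sa at_] <-].
  have aT : 0 <= a <= T by rewrite (le_trans s0 sa) (le_trans at_).
  rewrite /gamma lerBlDr -lerBlDl; apply: Hg => //.
  apply: le_trans (seminorm_triangle hB _ (X a) _) _; apply: lerD.
    apply: le_trans (HL _ _ aT sT) _; rewrite ler_wpM2l//.
    by rewrite distrC ger0_norm ?subr_ge0// lerD2r.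
  by rewrite (seminorm_distC hB); exact: Xk.
have := scheme_evi hB hG hF (tau0 k) (@xmin k) hgamma.
rewrite subnKC//.
have near a : 0 <= a <= T ->
    `|N (X a - xi) ^+ 2 - N (x k (Num.truncn (a / tau k)) - xi) ^+ 2| <=
    e * (1 + 2 * D).
  move=> aT; apply: le_trans (seminorm_sqr_dist hB _ _ _) _.
  have na : N (X a - x k (Num.truncn (a / tau k))) <= e.
    by rewrite (seminorm_distC hB); exact: Xk.
  apply: ler_pM; rewrite ?seminorm_ge0//.
    by rewrite addr_ge0 ?mulr_ge0 ?seminorm_ge0.
  by rewrite lerD ?(le_trans na)// ler_wpM2l// HD.
have d1 := le_trans (ler_norm _) (near t tT').
have d2 : N (x k m - xi) ^+ 2 - N (X s - xi) ^+ 2 <= e * (1 + 2 * D).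
  by apply: le_trans (ler_norm _) _; rewrite distrC near.
have b1 : tau k ^+ 2 / 8 * B (G (x k m)) (G (x k m)) <= e * (M ^+ 2 / 8).
  rewrite -(seminorm_sqr hB) mulrAC -mulrA; apply: ler_pM.
  - exact: sqr_ge0.
  - by rewrite divr_ge0// sqr_ge0.
  - apply: le_trans (tk); rewrite expr2 ler_piMr ?(ltW (tau0 k))//.
    exact: le_trans tk e1.
  - by rewrite ler_wpM2r// ler_sqr ?nnegrE ?seminorm_ge0// Gk.
(* Both rounding errors lie between 0 and [tau k], hence so does the absolute value of their
   difference. *)
have hd : `|(t - s) - tau k * (n - m)%:R| <= e.
  apply: le_trans tk; rewrite natrB//.
  have /andP[m1 m2] : m%:R <= s / tau k < m.+1%:R.
    by apply: truncn_itv; rewrite divr_ge0// ltW.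
  have /andP[n1 n2] : n%:R <= t / tau k < n.+1%:R.
    by apply: truncn_itv; rewrite divr_ge0 ?(le_trans s0 st)// ltW.
  move: m1 m2 n1 n2; rewrite !ler_pdivlMr// !ltr_pdivrMr// -![_.+1%:R]natr1.
  by rewrite ler_norml => *; apply/andP; split; lra.
have hG' : `|gamma| <= Gamma.
  apply: le_trans (ler_normB _ _) _; rewrite lerD2l ger0_norm.
    by rewrite ler_wpM2l.
  by rewrite mulr_ge0// addr_ge0 ?mulr_ge0 ?subr_ge0// ltW.
have d3 : (t - s) * gamma - tau k * (n - m)%:R * gamma <= e * Gamma.
  by rewrite -mulrBl; apply: le_trans (ler_norm _) _; rewrite normrM ler_pM.
have d4 : (t - s) * (kappa * e) <= T * (kappa * e).
  rewrite ler_wpM2r ?mulr_ge0 ?(ltW e0)//.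
  by rewrite lerBlDr (le_trans tT)// lerDl.
have egamma : (t - s) * gamma =
    (t - s) * g xi (X s) - (t - s) * (kappa * (L * (t - s) + e)).
  by rewrite -mulrBr.
clear -d1 d2 b1 d3 d4 egamma; clearbody kappa L Gamma D gamma.
move: d1 d2 b1 d3 d4 egamma.
move: (N (X t - xi) ^+ 2) (N (X s - xi) ^+ 2) (N (x k n - xi) ^+ 2).
move: (N (x k m - xi) ^+ 2) (tau k * _) (tau k ^+ 2 / 8 * _) (g xi (X s)).
move=> q1 tt bb gs q2 q3 q4; lra.
Qed.

Lemma limit_evi s t xi : 0 <= s -> s <= t ->
  (N (X t - xi) ^+ 2 - N (X s - xi) ^+ 2) / 2
  + lambda / 2 * Rintegral mu `[s, t] (fun a => N (X a - xi) ^+ 2)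
  + Rintegral mu `[s, t] (fun a => F (X a)) <= (t - s) * F xi.
Proof.
move=> s0 st; have T0 : 0 <= t by exact: le_trans st.
have [K0 HK0] := limit_local_evi xi T0.
have [M M0 [_ HM]] := limit_upper_bound T0.
have [L0 HL0] := Xlip T0; pose L := `|L0|.
have L_ge0 : 0 <= L by exact: normr_ge0.
have HL a b : 0 <= a <= t -> 0 <= b <= t ->
    N (X a - X b) <= L * `|a - b| <= L * t.
  move=> /[dup] ha /andP[a0 at_] /[dup] hb /andP[b0 bt]; apply/andP; split.
    by apply: le_trans (HL0 _ _ hb ha) _; rewrite ler_wpM2r// ler_norm.
  by rewrite ler_wpM2l// ler_norml; apply/andP; split; lra.
pose f1 a := N (X a - xi) ^+ 2; pose f2 a := F (X a).
pose D := N (X 0 - xi) + L * t.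
have HD a : 0 <= a <= t -> N (X a - xi) <= D.
  move=> aT; apply: le_trans (seminorm_triangle hB _ (X 0) _) _.
  rewrite addrC lerD2l.
  have z0 : 0 <= (0 : R) <= t by rewrite lexx.
  have /andP[h1 h2] := HL a 0 aT z0.
  exact: le_trans h1 h2.
have f1lip a b : 0 <= a <= t -> 0 <= b <= t ->
    `|f1 a - f1 b| <= (L * t + 2 * D) * L * `|a - b|.
  move=> ha hb; apply: le_trans (seminorm_sqr_dist hB _ _ _) _.
  have /andP[h1 h2] := HL a b ha hb.
  rewrite -mulrA [leRHS]mulrC; apply: ler_pM; rewrite ?seminorm_ge0//.
    by rewrite addr_ge0 ?mulr_ge0 ?seminorm_ge0.
  by rewrite lerD ?(le_trans h1 h2)// ler_wpM2l// HD.
have f2le a b : 0 <= a <= t -> 0 <= b <= t ->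
    f2 a - f2 b <= (M + `|lambda| / 2 * (L * t)) * L * `|a - b|.
  move=> ha hb; apply: le_trans (HM a (X b) ha) _.
  have /andP[h1 h2] := HL a b ha hb.
  rewrite expr2 [_ / 2 * (_ * _)]mulrA -mulrDl -[leRHS]mulrA; apply: ler_pM; rewrite ?seminorm_ge0//.
    by rewrite addr_ge0 ?mulr_ge0 ?seminorm_ge0 ?invr_ge0.
  by rewrite lerD2l ler_wpM2l ?divr_ge0// (le_trans h1 h2).
(* The one-sided estimate holds at every point of the curve, so exchanging [a] and [b] makes it
   two-sided. *)
have f2lip a b : 0 <= a <= t -> 0 <= b <= t ->
    `|f2 a - f2 b| <= (M + `|lambda| / 2 * (L * t)) * L * `|a - b|.
  move=> ha hb; rewrite ler_norml lerNl opprB f2le// andbT.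
  by rewrite distrC f2le.
(* The claim amounts to [w t <= w s]. In an increment of [w] the rectangle rule for both integrals
   cancels the first-order term of the local inequality, which leaves a quadratic error. *)
pose w b := f1 b / 2 + lambda / 2 * Rintegral mu `[s, b] f1
  + Rintegral mu `[s, b] f2 - (b - s) * F xi.
have : w t <= w s.
  pose K := K0 + `|lambda| / 2 * `|(L * t + 2 * D) * L|
    + `|(M + `|lambda| / 2 * (L * t)) * L|.
  apply: (@nonincreasing_of_quadratic_increments _ w K) => // a b sa ab bt.
  have a0 := le_trans s0 sa.
  have h : f1 b / 2 - f1 a / 2 <=
      - (b - a) * (f2 a + lambda / 2 * f1 a - F xi) + K0 * (b - a) ^+ 2.
    exact: HK0.
  have i1 := lipschitz_Rintegral_split f1lip s0 sa ab bt.
  have i2 := lipschitz_Rintegral_split f2lip s0 sa ab bt.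
  have j1 := lipschitz_Rintegral_approx f1lip a0 ab bt.
  have j2 := lipschitz_Rintegral_approx f2lip a0 ab bt.
  have {}j1 : lambda / 2 * (Rintegral mu `[a, b] f1 - (b - a) * f1 a) <=
      `|lambda| / 2 * (`|(L * t + 2 * D) * L| * (b - a) ^+ 2).
    apply: le_trans (ler_norm _) _; rewrite normrM normrM (@gtr0_norm _ 2^-1)//.
    by rewrite ler_wpM2l// divr_ge0.
  have {}j2 := le_trans (ler_norm _) j2.
  rewrite /w /K; clear -h i1 i2 j1 j2; clearbody f1 f2 L D.
  move: h i1 i2 j1 j2.
  move: (Rintegral mu `[s, a] f1) (Rintegral mu `[s, b] f1) => I1 I2.
  move: (Rintegral mu `[s, a] f2) (Rintegral mu `[s, b] f2) => J1 J2.
  move: (Rintegral _ _ _) (Rintegral _ _ _) => I J h i1 i2; rewrite -i1 -i2; lra.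
rewrite /w set_itv1 !Rintegral_set1 /f1 /f2; lra.
Qed.

End SchemeLimit.

(** * The space of square-integrable Borel maps *)

Section BorelMaps.
Context (R : realType) (d : nat).
Context (disp : measure_display) (T : measurableType disp).

Lemma measurable_coord (f : T -> borelRd R d) (i : 'I_d) :
  measurable_fun setT f -> measurable_fun setT (fun x => (f x : 'rV[R]_d) ord0 i).
Proof.
move=> mf.
have mc : measurable_fun setT (fun u : borelRd R d => (u : 'rV[R]_d) ord0 i).
  apply: (measurability _ (RGenOInfty.measurableE R)).
  move=> /= _ [_ [a ->]] <-; rewrite setTI; apply: sub_sigma_algebra.
  apply: (@open_comp 'rV[R]_d R (fun u => u ord0 i)) => [u _|].
    exact: coord_continuous.
  exact: interval_open.
exact: (measurableT_comp mc mf).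
Qed.

(* An open set is the countable union of the balls with rational centre and
   radius 1/(n+1) that it contains. *)
Lemma measurable_of_coord (f : T -> borelRd R d) :
  (forall i : 'I_d, measurable_fun setT (fun x => (f x : 'rV[R]_d) ord0 i)) ->
  measurable_fun setT f.
Proof.
move=> mf; apply: (@measurability _ _ T (borelRd R d) setT f (@open 'rV[R]_d)) => //.
move=> /= _ [U oU <-]; rewrite setTI.
pose box (q : 'rV[rat]_d) (n : nat) : set 'rV[R]_d :=
  [set u | forall i, `|ratr (q ord0 i) - u ord0 i| < n.+1%:R^-1].
(* Enumerates the boxes; a code that names no pair, or a box not contained in [U], contributes the
   empty set. *)
pose A (k : nat) : set 'rV[R]_d :=
  if unpickle k is Some p then
    if `[< box p.1 p.2 `<=` U >] then box p.1 p.2 else set0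
  else set0.
have -> : U = \bigcup_k A k.
  apply/seteqP; split => [x Ux|x [k _]]; last first.
    by rewrite /A; case: unpickle => // p; case: asboolP => // h /h.
  have : nbhs x U by move: oU; rewrite openE => /(_ _ Ux).
  move=> /nbhs_ballP[e /= e0 xeU].
  pose n := Num.truncn (2 / e).
  have n0 : 0 < n.+1%:R^-1 :> R by rewrite invr_gt0.
  (* Points of one box differ by less than twice its radius in each coordinate, so a box of this
     size around a rational point near [x] stays in the ball of radius [e]. *)
  have ne : n.+1%:R^-1 + n.+1%:R^-1 < e.
    have := truncnS_gt (2 / e); rewrite -/n ltr_pdivrMr// => h.
    by rewrite -mulr2n -[ltLHS]mulr_natl ltr_pdivrMr// mulrC.
  have /choice[q hq] : forall i : 'I_d, exists q : rat,
      `|ratr q - x ord0 i| < n.+1%:R^-1.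
    move=> i; have /rat_in_itvoo[q] :
        x ord0 i - n.+1%:R^-1 < x ord0 i + n.+1%:R^-1.
      by move: n0; move: (n.+1%:R^-1) => r; lra.
    rewrite in_itv/= => qx; exists q; rewrite ltr_norml; move: qx.
    by move: (n.+1%:R^-1) => r /andP[q1 q2]; apply/andP; split; lra.
  exists (pickle (\row_i q i, n)) => //; rewrite /A pickleK /=.
  case: asboolP => [_ i|]; first by rewrite mxE.
  case=> y hy; apply: xeU; split => // i j; rewrite (ord1 i) /ball /=.
  have := hy j; rewrite mxE => hy'; apply: le_lt_trans ne.
  rewrite -(subrKA (ratr (q j))) addrC; apply: le_trans (ler_normD _ _) _.
  by apply: ltW; apply: ltrD => //; rewrite distrC; exact: hq.
rewrite preimage_bigcup; apply: bigcup_measurable => k _.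
rewrite /A; case: unpickle => [p|]; last by rewrite preimage_set0.
case: asboolP => _; last by rewrite preimage_set0.
have -> : f @^-1` box p.1 p.2 =
    \bigcap_(i in [set: 'I_d])
      [set x | `|ratr (p.1 ord0 i) - (f x : 'rV[R]_d) ord0 i| < p.2.+1%:R^-1].
  by apply/seteqP; split => x /= h i => [_|]; exact: h.
apply: fin_bigcap_measurable => // i _.
have mg : measurable_fun setT
    (fun x => `|ratr (p.1 ord0 i) - (f x : 'rV[R]_d) ord0 i|).
  by apply: measurableT_comp => //; apply: measurable_funB.
have := mg measurableT `]-oo, p.2.+1%:R^-1[%classic (measurable_itv _).
by rewrite setTI.
Qed.

End BorelMaps.

(** * The module of square-integrable Borel maps *)

Section L2.
Context (R : realType) (d : nat) (rho0 : probability (borelRd R d) R).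
Implicit Types (f g h : 'rV[R]_d -> 'rV[R]_d) (u v w : 'rV[R]_d).

Lemma dotRdC u v : dotRd u v = dotRd v u.
Proof. by apply: eq_bigr => i _; rewrite mulrC. Qed.

Lemma dotRd_linearl a u v w : dotRd (a *: u + v) w = a * dotRd u w + dotRd v w.
Proof.
rewrite /dotRd mulr_sumr -big_split /=; apply: eq_bigr => i _.
by rewrite !mxE mulrDl mulrA.
Qed.

Lemma dotRd_ge0 u : 0 <= dotRd u u.
Proof. by apply: sumr_ge0 => i _; rewrite -expr2 sqr_ge0. Qed.

Lemma sqnormRd_linear a u v : sqnormRd (a *: u + v) =
  a ^+ 2 * sqnormRd u + (2 * a * dotRd u v + sqnormRd v).
Proof.
rewrite /sqnormRd dotRd_linearl 2!(dotRdC _ (a *: u + v)) !dotRd_linearl.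
by rewrite (dotRdC v u); ring.
Qed.

Lemma normr_dotRd_le u v : `|dotRd u v| <= sqnormRd u + sqnormRd v.
Proof.
have := dotRd_ge0 (1 *: u + v); have := dotRd_ge0 ((-1) *: u + v).
have := dotRd_ge0 u; have := dotRd_ge0 v.
rewrite -!/(sqnormRd _) !sqnormRd_linear ler_norml => *.
by apply/andP; split; lra.
Qed.

(** The pairing is dominated by the sum of the two squared norms. *)
Lemma integrable_dotRd f g : inH rho0 f -> inH rho0 g ->
  rho0.-integrable setT (fun x : borelRd R d => (dotRd (f x) (g x))%:E).
Proof.
move=> [mf If] [mg Ig].
apply: (@le_integrable _ _ _ rho0 setT _ _
  (fun x : borelRd R d => ((sqnormRd (f x))%:E + (sqnormRd (g x))%:E)%E)) => //.
- apply/measurable_EFinP; apply: measurable_sum => i.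
  by apply: measurable_funM; exact: measurable_coord.
- move=> x _ /=; rewrite lee_fin; apply: le_trans (normr_dotRd_le _ _) _.
  exact: ler_norm.
- exact: integrableD.
Qed.

Lemma inH0 : inH rho0 0.
Proof.
split; first exact: measurable_cst.
apply: eq_integrable (integrable0 _ _) => //= x _.
by rewrite /sqnormRd /dotRd big1// => i _; rewrite mxE mul0r.
Qed.

Lemma inH_linear a f g : inH rho0 f -> inH rho0 g -> inH rho0 (a *: f + g).
Proof.
move=> /[dup] Hf [mf If] /[dup] Hg [mg Ig]; split.
  apply: measurable_of_coord => i.
  apply: (eq_measurable_fun (fun x : borelRd R d =>
    a * (f x) ord0 i + (g x) ord0 i)) => [x _|]; first by rewrite !mxE.
  apply: measurable_funD; last exact: measurable_coord.
  by apply: measurable_funM => //; exact: measurable_coord.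
apply: (eq_integrable _ (fun x : borelRd R d =>
  ((a ^+ 2)%:E * (sqnormRd (f x))%:E +
   ((2 * a)%:E * (dotRd (f x) (g x))%:E + (sqnormRd (g x))%:E))%E)) => //.
  by move=> x _; rewrite -!EFinM -!EFinD -sqnormRd_linear.
apply: integrableD => //; first exact: integrableZl.
apply: integrableD => //; apply: integrableZl => //; exact: integrable_dotRd.
Qed.

Lemma innerHC f g : innerH rho0 f g = innerH rho0 g f.
Proof. by apply: eq_Rintegral => x _; rewrite dotRdC. Qed.

Lemma innerH_linearl a f g h : inH rho0 f -> inH rho0 g -> inH rho0 h ->
  innerH rho0 (a *: f + g) h = a * innerH rho0 f h + innerH rho0 g h.
Proof.
move=> Hf Hg Hh; rewrite /innerH.
under eq_Rintegral do rewrite dotRd_linearl.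
rewrite RintegralD//=.
- by rewrite RintegralZl//; exact: integrable_dotRd.
- apply: (eq_integrable _ (fun x : borelRd R d =>
    (a%:E * (dotRd (f x) (h x))%:E)%E)) => //.
  by apply: integrableZl => //; exact: integrable_dotRd.
- exact: integrable_dotRd.
Qed.

Lemma innerH_ge0 f : 0 <= innerH rho0 f f.
Proof. by apply: Rintegral_ge0 => x _; exact: dotRd_ge0. Qed.

Definition L2pred : {pred 'rV[R]_d -> 'rV[R]_d} := fun f => `[< inH rho0 f >].

Lemma L2pred_submod_closed : submod_closed L2pred.
Proof.
split; first by apply/asboolP; exact: inH0.
by move=> a f g /asboolP Hf /asboolP Hg; apply/asboolP; exact: inH_linear.
Qed.

HB.instance Definition _ := GRing.isSubmodClosed.Build R _ L2pred L2pred_submod_closed.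

(** Bundles [inH] into a type so that the abstract results apply. Elements are maps rather than
    classes modulo null sets, so [L2inner] is only semidefinite. *)
Record L2space := L2Space { L2val : 'rV[R]_d -> 'rV[R]_d ; _ : L2val \in L2pred }.

HB.instance Definition _ := [isSub for L2val].
HB.instance Definition _ := [Choice of L2space by <:].
HB.instance Definition _ := [SubChoice_isSubLmodule of L2space by <:].

Lemma L2valP (u : L2space) : inH rho0 (val u).
Proof. by have /asboolP := valP u. Qed.

Definition L2inner (u v : L2space) : R := innerH rho0 (val u) (val v).

Lemma L2inner_semi : semi_inner_product L2inner.
Proof.
split=> [u v|a u v w|u]; first exact: innerHC.
  by rewrite /L2inner linearP innerH_linearl//; exact: L2valP.
exact: innerH_ge0.
Qed.

(** Maps outside [inH] are sent to the default 0. *)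
Definition toL2 (f : 'rV[R]_d -> 'rV[R]_d) : L2space := insubd 0 f.

Lemma toL2K f : inH rho0 f -> val (toL2 f) = f.
Proof. by move=> Hf; rewrite insubdK//; exact/asboolP. Qed.

Lemma seminorm_L2inner (u : L2space) : seminorm_of L2inner u = normH rho0 (val u).
Proof. by []. Qed.

End L2.

(** * Transfer of the abstract inequality to square-integrable maps *)

Theorem mainTheorem14 (R : realType) (d : nat)
    (rho0 : probability (borelRd R d) R)
    (phi : (set (borelRd R d) -> \bar R) -> R)
    (gradphi : ('rV[R]_d -> 'rV[R]_d) -> ('rV[R]_d -> 'rV[R]_d))
    (lambda : R)
    (tau : nat -> R)
    (X : nat -> nat -> ('rV[R]_d -> 'rV[R]_d))
    (Xlim : R -> ('rV[R]_d -> 'rV[R]_d)) :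
  (* standing hypotheses (S) *)
  in_P2 rho0 ->
  frechet_gradient rho0 (phi_lift rho0 phi) gradphi ->
  lambda_convexH rho0 (phi_lift rho0 phi) lambda ->
  bounded_belowH rho0 (phi_lift rho0 phi) ->
  (* the family tau_k decreasing to 0 *)
  (forall k, 0 < tau k) ->
  tau @ \oo --> (0 : R) ->
  (forall k, 0 < lambda / 2 + (tau k)^-1) ->
  (lambda < 0 -> forall k, `|lambda| * tau k < 1) ->
  (* the scheme, for every tau_k *)
  (forall k, inH rho0 (X k 0%N)) ->
  (forall k n, scheme_step rho0 (phi_lift rho0 phi) gradphi (tau k) (X k n) (X k n.+1)) ->
  (* initial data *)
  (fun k => normH rho0 (subF (X k 0%N) id)) @ \oo --> (0 : R) ->
  (exists C : R, forall k, normH rho0 (gradphi (X k 0%N)) <= C) ->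
  (* X is a curve [0,oo) -> H, locally Lipschitz *)
  (forall t : R, 0 <= t -> inH rho0 (Xlim t)) ->
  (forall T : R, 0 <= T -> exists L : R, forall s t : R,
      0 <= s <= T -> 0 <= t <= T ->
      normH rho0 (subF (Xlim t) (Xlim s)) <= L * `|t - s|) ->
  (* locally uniform convergence in H of the interpolants to X *)
  (forall T : R, 0 <= T -> forall eps : R, 0 < eps -> exists K : nat,
      forall k, (K <= k)%N -> forall t : R, 0 <= t <= T ->
        normH rho0 (subF (interp (tau k) (X k) t) (Xlim t)) <= eps) ->
  (* conclusion *)
  forall s t : R, 0 <= s -> s <= t ->
  forall xi, inH rho0 xi ->
    ((normH rho0 (subF (Xlim t) xi)) ^+ 2 - (normH rho0 (subF (Xlim s) xi)) ^+ 2) / 2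
    + lambda / 2 * Rintegral lebesgue_measure `[s, t]
                     (fun a => (normH rho0 (subF (Xlim a) xi)) ^+ 2)
    + Rintegral lebesgue_measure `[s, t] (fun a => phi_lift rho0 phi (Xlim a))
    <= (t - s) * phi_lift rho0 phi xi.
Proof.
move: (phi_lift rho0 phi) => phis _ hgrad hconv _ tau0 tau_cvg _ _ hX0 hstep _ [C hC] hXlim hlip hcvg.
move=> s t s0 st xi hxi.
have hX k n : inH rho0 (X k n) by case: n => [|n]; [|case: (hstep k n)].
pose F (u : L2space rho0) := phis (val u).
pose G (u : L2space rho0) := toL2 rho0 (gradphi (val u)).
have valG u : val (G u) = gradphi (val u).
  by apply: toL2K; case: (hgrad _ (L2valP u)).
have hB := L2inner_semi rho0.
have hG : gradient_of (@L2inner R d rho0) F G.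
  move=> u e e0; have [_ /(_ e e0)[delta d0 H]] := hgrad _ (L2valP u).
  exists delta => // h hh; rewrite /L2inner valG.
  exact: H (L2valP h) hh.
have hF : lambda_convex (@L2inner R d rho0) F lambda.
  by move=> u v a ha; exact: hconv (L2valP u) (L2valP v) _ ha.
pose x k n := toL2 rho0 (X k n).
have valx k n : val (x k n) = X k n by exact: toL2K.
(* For [a < 0] this may be the default 0; all later identifications with [Xlim] are at nonnegative
   times. *)
pose Y a := toL2 rho0 (Xlim a).
have valY a : 0 <= a -> val (Y a) = Xlim a by move=> a0; apply: toL2K; exact: hXlim.
have xmin k n y : step_objective (@L2inner R d rho0) F G (tau k) (x k n) (x k n.+1) <=
    step_objective (@L2inner R d rho0) F G (tau k) (x k n) y.
  have [_ /(_ _ (L2valP y))] := hstep k n.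
  rewrite /scheme_objective /step_objective /F /L2inner valG !seminorm_L2inner.
  by rewrite !raddfB /= !valx.
have xC k : seminorm_of (@L2inner R d rho0) (G (x k 0%N)) <= C.
  by rewrite seminorm_L2inner valG valx.
have Ylip T : 0 <= T -> exists L, forall s t, 0 <= s <= T -> 0 <= t <= T ->
    seminorm_of (@L2inner R d rho0) (Y t - Y s) <= L * `|t - s|.
  move=> /hlip[L HL]; exists L => a b ha hb; rewrite seminorm_L2inner raddfB /=.
  case/andP: (ha) => a0 _; case/andP: (hb) => b0 _.
  by rewrite !valY//; exact: HL.
have Ycvg T : 0 <= T -> forall eps, 0 < eps -> exists K,
    forall k, (K <= k)%N -> forall t, 0 <= t <= T ->
    seminorm_of (@L2inner R d rho0) (x k (Num.truncn (t / tau k)) - Y t) <= eps.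
  move=> T0 e e0; have [K HK] := hcvg T T0 e e0; exists K => k Kk a ha.
  case/andP: (ha) => a0 _.
  by rewrite seminorm_L2inner raddfB /= valx valY//; exact: HK.
have t0 := le_trans s0 st.
have sq a : 0 <= a -> seminorm_of (@L2inner R d rho0) (Y a - toL2 rho0 xi) =
    normH rho0 (subF (Xlim a) xi).
  by move=> a0; rewrite seminorm_L2inner raddfB /= valY// toL2K.
have I1 : Rintegral lebesgue_measure `[s, t]
      (fun a => seminorm_of (@L2inner R d rho0) (Y a - toL2 rho0 xi) ^+ 2) =
    Rintegral lebesgue_measure `[s, t] (fun a => normH rho0 (subF (Xlim a) xi) ^+ 2).
  apply: eq_Rintegral => a; rewrite inE/= in_itv/= => /andP[sa _].
  by rewrite sq// (le_trans s0 sa).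
have I2 : Rintegral lebesgue_measure `[s, t] (fun a => F (Y a)) =
    Rintegral lebesgue_measure `[s, t] (fun a => phis (Xlim a)).
  apply: eq_Rintegral => a; rewrite inE/= in_itv/= => /andP[sa _].
  by congr phis; apply: valY; exact: le_trans sa.
have := limit_evi hB hG hF tau0 tau_cvg xmin xC Ylip Ycvg (toL2 rho0 xi) s0 st.
have Fxi : F (toL2 rho0 xi) = phis xi by congr phis; exact: toL2K.
by rewrite I1 I2 (sq _ t0) (sq _ s0) Fxi.
Qed.
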